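(* Let $K$ be a field of characteristic zero and let $\mathfrak{f}_{r,c}$ be the free $c$-step nilpotent Lie algebra over $K$ on $r$ generators. Then $\mathrm{AID}(\mathfrak{f}_{r,c}) = \mathrm{Inn}(\mathfrak{f}_{r,c})$.
   Context: For a finite-dimensional Lie algebra $\mathfrak{g}$ over a field $K$, let $\mathrm{Der}(\mathfrak{g})$ be its Lie algebra of derivations and $\mathrm{Inn}(\mathfrak{g})=\{\mathrm{ad}(x)\mid x\in\mathfrak{g}\}$ the inner derivations. A derivation $D\in\mathrm{Der}(\mathfrak{g})$ is called almost inner if $D(x)\in[\mathfrak{g},x]=\{[y,x]\mid y\in\mathfrak{g}\}$ for all $x\in\mathfrak{g}$. The space of almost inner derivations is denoted $\mathrm{AID}(\mathfrak{g})$. The lower central series is $\mathfrak{g}^1=\mathfrak{g}$, $\mathfrak{g}^i=[\mathfrak{g},\mathfrak{g}^{i-1}]$ for $i\ge 2$. The free $c$-step nilpotent Lie algebra on $r$ generators ($r,c\geq 1$) is $\mathfrak{f}_{r,c}=\mathfrak{f}_r/\mathfrak{f}_r^{c+1}$, where $\mathfrak{f}_r$ is the free Lie algebra over $K$ on $r$ generators. *)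

(* Defs.v *)
From HB Require Import structures.
From mathcomp Require Import all_boot all_order all_algebra.
From mathcomp Require Import boolp classical_sets.

Set Implicit Arguments.
Unset Strict Implicit.
Unset Printing Implicit Defensive.

Import GRing.Theory.

Local Open Scope classical_set_scope.
Local Open Scope ring_scope.
Local Open Scope quotient_scope.

HB.mixin Record Lmodule_isLieAlgebra (K : fieldType) (L : Type)
    of GRing.Lmodule K L := {
  lie : L -> L -> L;
  lie_linearl : forall z, linear (lie^~ z);
  lie_linearr : forall z, linear (lie z);
  liexx : forall x, lie x x = 0;
  lie_jacobi : forall x y z,
    lie x (lie y z) + lie y (lie z x) + lie z (lie x y) = 0
}.

#[short(type="lieAlgType")]
HB.structure Definition LieAlgebra (K : fieldType) :=
  { L of GRing.Lmodule K L & Lmodule_isLieAlgebra K L }.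

Notation "{[ x , y ]}" := (lie x y) (format "{[ x ,  y ]}") : ring_scope.

Definition lie_morphism (K : fieldType) (L M : lieAlgType K) (f : L -> M) :=
  linear f /\ forall x y, f {[x, y]} = {[f x, f y]}.

Section LieTheory.
Variables (K : fieldType) (L : lieAlgType K).
Implicit Types (A B : set L) (D : L -> L) (x y z : L).

HB.instance Definition _ z :=
  GRing.isLinear.Build K L L *:%R (lie z) (lie_linearr z).

Lemma lieDl x y z : {[x + y, z]} = {[x, z]} + {[y, z]}.
Proof. by have := lie_linearl z 1 x y; rewrite !scale1r. Qed.

Lemma lieDr z x y : {[z, x + y]} = {[z, x]} + {[z, y]}.
Proof. exact: raddfD. Qed.

Lemma lie0x z : {[0 : L, z]} = 0.
Proof. by apply: (addIr {[0, z]}); rewrite -lieDl !add0r. Qed.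

Lemma lieZl a x z : {[a *: x, z]} = a *: {[x, z]}.
Proof. by have := lie_linearl z a x 0; rewrite /= !addr0 lie0x addr0. Qed.

Lemma lieZr a z x : {[z, a *: x]} = a *: {[z, x]}.
Proof. exact: linearZ. Qed.

Lemma lieC x y : {[x, y]} = - {[y, x]}.
Proof.
apply/eqP; rewrite -addr_eq0; apply/eqP.
by have := liexx (x + y); rewrite lieDl !lieDr !liexx add0r addr0.
Qed.

Lemma lieBr z x y : {[z, x - y]} = {[z, x]} - {[z, y]}.
Proof. exact: raddfB. Qed.

Lemma lieBl x y z : {[x - y, z]} = {[x, z]} - {[y, z]}.
Proof. by rewrite lieC lieBr opprB [X in X - _]lieC [X in _ - X]lieC opprK addrC. Qed.

Definition lie_span A : set L := smallest (fun B => submod_closed [in B]) A.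

Definition lie_prod A B : set L :=
  lie_span [set z | exists2 x, A x & exists2 y, B y & z = {[x, y]}].

(* Indexed as in g^1 = g, g^i = [g, g^(i-1)]; the value at 0 is a dummy *)
Fixpoint lcs (i : nat) : set L :=
  match i with
  | 0 | 1 => setT
  | i'.+1 => lie_prod setT (lcs i')
  end.

Definition ad x : L -> L := lie x.

Definition Der : set (L -> L) :=
  [set D | linear D /\ forall x y, D {[x, y]} = {[D x, y]} + {[x, D y]}].

Definition Inn : set (L -> L) := [set ad x | x in setT].

Definition AID : set (L -> L) :=
  [set D | Der D /\ forall x, [set {[y, x]} | y in setT] (D x)].

Record lieIdeal := LieIdeal {
  ideal_set : set L;
  ideal_submod : submod_closed [in ideal_set];
  ideal_lie : forall x y, ideal_set y -> ideal_set {[x, y]}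
}.

Lemma lie_span_submod A : submod_closed [in lie_span A].
Proof.
split=> [|a x y]; rewrite !inE.
  by move=> B /= [[B0 _] _]; rewrite inE in B0.
move=> Sx Sy B /= [Bsub AB].
have Bx : x \in B by rewrite inE; apply: Sx.
have By : y \in B by rewrite inE; apply: Sy.
by have := Bsub.2 a x y Bx By; rewrite inE.
Qed.

Lemma lcs_submod i : submod_closed [in lcs i].
Proof.
case: i => [|[|i]]; last exact: lie_span_submod.
  by split=> [|a x y _ _]; rewrite inE.
by split=> [|a x y _ _]; rewrite inE.
Qed.

Lemma lcsSS i : lcs i.+2 = lie_prod setT (lcs i.+1).
Proof. by []. Qed.

Lemma lcs_lie i x y : lcs i y -> lcs i {[x, y]}.
Proof.
elim: i x y => [|i IH] x y Hy; first by [].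
case: i IH Hy => [|i] IH Hy; first by [].
have Hsub : lcs i.+2 `<=` lcs i.+1.
  apply: smallest_sub; first exact: lcs_submod.
  by move=> _ [u _ [v Hv ->]]; apply: IH.
apply: sub_gen_smallest; exists x => //; exists y => //; exact: Hsub.
Qed.

Definition lcs_ideal i : lieIdeal := LieIdeal (@lcs_submod i) (@lcs_lie i).

End LieTheory.

Arguments lcs {K} L i.
Arguments lcs_ideal {K} L i.
Arguments Der {K} L.
Arguments Inn {K} L.
Arguments AID {K} L.

Section LieQuotient.
Variables (K : fieldType) (L : lieAlgType K) (I : lieIdeal L).

Definition ideal_pred : {pred L} := fun x => `[< ideal_set I x >].

Lemma ideal_predE x : (x \in ideal_pred) = (x \in ideal_set I).
Proof. by []. Qed.

Lemma ideal_pred_submod : submod_closed ideal_pred.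
Proof. exact: ideal_submod. Qed.

HB.instance Definition _ :=
  GRing.isSubmodClosed.Build K L ideal_pred ideal_pred_submod.

Lemma ideal_pred_lier x y : y \in ideal_pred -> {[x, y]} \in ideal_pred.
Proof. by rewrite !ideal_predE !inE; apply: ideal_lie. Qed.

Lemma ideal_pred_liel x y : x \in ideal_pred -> {[x, y]} \in ideal_pred.
Proof. by move=> xI; rewrite lieC rpredN ideal_pred_lier. Qed.

Definition lie_quot : Type := Quotient.quot ideal_pred.

HB.instance Definition _ := GRing.Zmodule.on lie_quot.

Definition lie_pi (x : L) : lie_quot := \pi_(Quotient.quot ideal_pred) x.

Definition lie_repr (u : lie_quot) : L :=
  repr (u : Quotient.quot ideal_pred).

Lemma lie_reprK : cancel lie_repr lie_pi.
Proof. exact: reprK. Qed.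

Lemma lie_piP x y : lie_pi x = lie_pi y <-> ideal_set I (x - y).
Proof.
split=> [/eqP|Ixy].
  by rewrite -Quotient.idealrBE => /asboolP.
by apply/eqP; rewrite -Quotient.idealrBE; apply/asboolP.
Qed.

Lemma lie_piD x y : lie_pi (x + y) = lie_pi x + lie_pi y.
Proof. exact: Quotient.pi_add. Qed.

Lemma lie_repr_pi x : lie_repr (lie_pi x) - x \in ideal_pred.
Proof. by apply/asboolP/lie_piP; rewrite lie_reprK. Qed.

Definition quot_scale (a : K) (u : lie_quot) := lie_pi (a *: lie_repr u).

Lemma quot_scaleE a x : quot_scale a (lie_pi x) = lie_pi (a *: x).
Proof.
by apply/lie_piP/asboolP; rewrite -scalerBr; apply: rpredZ (lie_repr_pi x).
Qed.

Lemma quot_scaleA a b u :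
  quot_scale a (quot_scale b u) = quot_scale (a * b) u.
Proof. by rewrite -(lie_reprK u) !quot_scaleE scalerA. Qed.

Lemma quot_scale1 : left_id 1 quot_scale.
Proof. by move=> u; rewrite -(lie_reprK u) !quot_scaleE scale1r. Qed.

Lemma quot_scaleDr : right_distributive quot_scale +%R.
Proof.
move=> a u v; rewrite -(lie_reprK u) -(lie_reprK v).
by rewrite -lie_piD !quot_scaleE scalerDr lie_piD.
Qed.

Lemma quot_scaleDl u : {morph quot_scale^~ u : a b / a + b}.
Proof.
by move=> a b /=; rewrite -(lie_reprK u) !quot_scaleE scalerDl lie_piD.
Qed.

HB.instance Definition _ := GRing.Zmodule_isLmodule.Build K lie_quot
  quot_scaleA quot_scale1 quot_scaleDr quot_scaleDl.

Lemma lie_piZ a x : lie_pi (a *: x) = a *: lie_pi x.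
Proof. by rewrite -quot_scaleE. Qed.

Definition quot_lie (u v : lie_quot) := lie_pi {[lie_repr u, lie_repr v]}.

Lemma quot_lieE x y : quot_lie (lie_pi x) (lie_pi y) = lie_pi {[x, y]}.
Proof.
apply/lie_piP/asboolP; set x' := lie_repr _; set y' := lie_repr _.
rewrite -[`[< _ >]]/(_ \in ideal_pred).
have -> : {[x', y']} - {[x, y]} = {[x' - x, y']} + {[x, y' - y]}.
  by rewrite lieBl lieBr addrA subrK.
by apply: rpredD; [apply: ideal_pred_liel|apply: ideal_pred_lier];
  apply: lie_repr_pi.
Qed.

Lemma quot_lie_linearl w : linear (quot_lie^~ w).
Proof.
move=> a u v /=; rewrite -(lie_reprK u) -(lie_reprK v) -(lie_reprK w).
by rewrite -lie_piZ -lie_piD !quot_lieE lieDl lieZl lie_piD lie_piZ.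
Qed.

Lemma quot_lie_linearr w : linear (quot_lie w).
Proof.
move=> a u v /=; rewrite -(lie_reprK u) -(lie_reprK v) -(lie_reprK w).
by rewrite -lie_piZ -lie_piD !quot_lieE lieDr lieZr lie_piD lie_piZ.
Qed.

Lemma lie_pi0 : lie_pi 0 = 0.
Proof. by apply: (addIr (lie_pi 0)); rewrite -lie_piD !add0r. Qed.

Lemma quot_liexx u : quot_lie u u = 0.
Proof. by rewrite -(lie_reprK u) quot_lieE liexx lie_pi0. Qed.

Lemma quot_lie_jacobi u v w :
  quot_lie u (quot_lie v w) + quot_lie v (quot_lie w u)
    + quot_lie w (quot_lie u v) = 0.
Proof.
rewrite -(lie_reprK u) -(lie_reprK v) -(lie_reprK w) !quot_lieE -!lie_piD.
by rewrite lie_jacobi lie_pi0.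
Qed.

HB.instance Definition _ := Lmodule_isLieAlgebra.Build K lie_quot
  quot_lie_linearl quot_lie_linearr quot_liexx quot_lie_jacobi.

Lemma lie_pi_morphism : lie_morphism lie_pi.
Proof.
by split=> [a x y|x y]; rewrite ?lie_piD ?lie_piZ // -quot_lieE.
Qed.

End LieQuotient.

Section FreeLie.
Variables (K : fieldType) (r : nat).

(* The free Lie algebra is built as the algebra of formal Lie expressions in
   the generators modulo the congruence generated by the axioms of Lie
   algebras over K; its universal property is free_lie_universal below. *)
Inductive lie_expr : Type :=
  | ExVar of 'I_r
  | ExZero
  | ExAdd of lie_expr & lie_expr
  | ExScale of K & lie_expr
  | ExLie of lie_expr & lie_expr.

Inductive expr_eq : lie_expr -> lie_expr -> Prop :=
  | ExRefl s : expr_eq s s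
  | ExSym s t : expr_eq s t -> expr_eq t s
  | ExTrans s t u : expr_eq s t -> expr_eq t u -> expr_eq s u
  | ExAddCongr s s' t t' :
      expr_eq s s' -> expr_eq t t' -> expr_eq (ExAdd s t) (ExAdd s' t')
  | ExScaleCongr a s s' :
      expr_eq s s' -> expr_eq (ExScale a s) (ExScale a s')
  | ExLieCongr s s' t t' :
      expr_eq s s' -> expr_eq t t' -> expr_eq (ExLie s t) (ExLie s' t')
  | ExAddA s t u : expr_eq (ExAdd s (ExAdd t u)) (ExAdd (ExAdd s t) u)
  | ExAddC s t : expr_eq (ExAdd s t) (ExAdd t s)
  | ExAdd0 s : expr_eq (ExAdd ExZero s) s
  | ExAddN s : expr_eq (ExAdd (ExScale (-1) s) s) ExZero
  | ExScaleA a b s : expr_eq (ExScale a (ExScale b s)) (ExScale (a * b) s)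
  | ExScale1 s : expr_eq (ExScale 1 s) s
  | ExScaleDr a s t :
      expr_eq (ExScale a (ExAdd s t)) (ExAdd (ExScale a s) (ExScale a t))
  | ExScaleDl a b s :
      expr_eq (ExScale (a + b) s) (ExAdd (ExScale a s) (ExScale b s))
  | ExLieLinearl a s t u :
      expr_eq (ExLie (ExAdd (ExScale a s) t) u)
              (ExAdd (ExScale a (ExLie s u)) (ExLie t u))
  | ExLieLinearr a s t u :
      expr_eq (ExLie u (ExAdd (ExScale a s) t))
              (ExAdd (ExScale a (ExLie u s)) (ExLie u t))
  | ExLiexx s : expr_eq (ExLie s s) ExZero
  | ExJacobi s t u :
      expr_eq (ExAdd (ExAdd (ExLie s (ExLie t u)) (ExLie t (ExLie u s)))
                     (ExLie u (ExLie s t)))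
              ExZero.

HB.instance Definition _ := gen_eqMixin lie_expr.
HB.instance Definition _ := gen_choiceMixin lie_expr.

Definition expr_eqb : rel lie_expr := fun s t => `[< expr_eq s t >].

Lemma expr_eqb_equiv : equiv_class_of expr_eqb.
Proof.
split=> [s|s t|t s u].
- by apply/asboolP; apply: ExRefl.
- by apply/asboolP/asboolP; apply: ExSym.
- by move=> /asboolP st /asboolP tu; apply/asboolP; apply: ExTrans st tu.
Qed.

Canonical expr_eqb_equiv_rel := EquivRelPack expr_eqb_equiv.
Canonical expr_eqb_encModRel := defaultEncModRel expr_eqb.

Definition free_lie := {eq_quot expr_eqb}.

HB.instance Definition _ := EqQuotient.on free_lie.
HB.instance Definition _ := Choice.on free_lie.

Definition free_pi (s : lie_expr) : free_lie := \pi_free_lie s.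

Lemma free_reprK : cancel (fun u : free_lie => repr u) free_pi.
Proof. exact: reprK. Qed.

Lemma free_piP s t : free_pi s = free_pi t <-> expr_eq s t.
Proof.
by split=> [/eqquotP/asboolP|st] //; apply/eqquotP/asboolP.
Qed.

Lemma free_repr_pi s : expr_eq (repr (free_pi s)) s.
Proof. by apply/free_piP; apply: free_reprK. Qed.

Definition free_gen (i : 'I_r) : free_lie := free_pi (ExVar i).
Definition free_zero : free_lie := free_pi ExZero.
Definition free_add (u v : free_lie) := free_pi (ExAdd (repr u) (repr v)).
Definition free_scale a (u : free_lie) := free_pi (ExScale a (repr u)).
Definition free_bracket (u v : free_lie) := free_pi (ExLie (repr u) (repr v)).
Definition free_opp := free_scale (-1).

Lemma free_addE s t : free_add (free_pi s) (free_pi t) = free_pi (ExAdd s t).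
Proof. by apply/free_piP; apply: ExAddCongr; apply: free_repr_pi. Qed.

Lemma free_scaleE a s : free_scale a (free_pi s) = free_pi (ExScale a s).
Proof. by apply/free_piP; apply: ExScaleCongr; apply: free_repr_pi. Qed.

Lemma free_bracketE s t :
  free_bracket (free_pi s) (free_pi t) = free_pi (ExLie s t).
Proof. by apply/free_piP; apply: ExLieCongr; apply: free_repr_pi. Qed.

Lemma free_ind (P : free_lie -> Prop) : (forall s, P (free_pi s)) -> forall u, P u.
Proof. by move=> HP u; rewrite -(free_reprK u). Qed.

Lemma free_addA : associative free_add.
Proof.
elim/free_ind=> s; elim/free_ind=> t; elim/free_ind=> u.
by rewrite !free_addE; apply/free_piP; apply: ExAddA.
Qed.

Lemma free_addC : commutative free_add.
Proof.
elim/free_ind=> s; elim/free_ind=> t.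
by rewrite !free_addE; apply/free_piP; apply: ExAddC.
Qed.

Lemma free_add0 : left_id free_zero free_add.
Proof.
by elim/free_ind=> s; rewrite free_addE; apply/free_piP; apply: ExAdd0.
Qed.

Lemma free_addN : left_inverse free_zero free_opp free_add.
Proof.
elim/free_ind=> s; rewrite /free_opp free_scaleE free_addE.
by apply/free_piP; apply: ExAddN.
Qed.

HB.instance Definition _ :=
  GRing.isZmodule.Build free_lie free_addA free_addC free_add0 free_addN.

Lemma free_piD s t : free_pi (ExAdd s t) = free_pi s + free_pi t.
Proof. by rewrite -free_addE. Qed.

Lemma free_scaleA a b u : free_scale a (free_scale b u) = free_scale (a * b) u.
Proof.
elim/free_ind: u => s; rewrite !free_scaleE.
by apply/free_piP; apply: ExScaleA.
Qed.

Lemma free_scale1 : left_id 1 free_scale.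
Proof.
by elim/free_ind=> s; rewrite free_scaleE; apply/free_piP; apply: ExScale1.
Qed.

Lemma free_scaleDr : right_distributive free_scale +%R.
Proof.
move=> a; elim/free_ind=> s; elim/free_ind=> t.
rewrite -free_piD !free_scaleE -free_piD.
by apply/free_piP; apply: ExScaleDr.
Qed.

Lemma free_scaleDl u : {morph free_scale^~ u : a b / a + b}.
Proof.
move=> a b; elim/free_ind: u => s; rewrite !free_scaleE -free_piD.
by apply/free_piP; apply: ExScaleDl.
Qed.

HB.instance Definition _ := GRing.Zmodule_isLmodule.Build K free_lie
  free_scaleA free_scale1 free_scaleDr free_scaleDl.

Lemma free_piZ a s : free_pi (ExScale a s) = a *: free_pi s.
Proof. by rewrite -free_scaleE. Qed.

Lemma free_bracket_linearl w : linear (free_bracket^~ w).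
Proof.
elim/free_ind: w => w a; elim/free_ind=> s; elim/free_ind=> t.
rewrite -free_piZ -free_piD !free_bracketE -free_piZ -free_piD.
by apply/free_piP; apply: ExLieLinearl.
Qed.

Lemma free_bracket_linearr w : linear (free_bracket w).
Proof.
elim/free_ind: w => w a; elim/free_ind=> s; elim/free_ind=> t.
rewrite -free_piZ -free_piD !free_bracketE -free_piZ -free_piD.
by apply/free_piP; apply: ExLieLinearr.
Qed.

Lemma free_bracketxx u : free_bracket u u = 0.
Proof.
by elim/free_ind: u => s; rewrite free_bracketE; apply/free_piP; apply: ExLiexx.
Qed.

Lemma free_jacobi u v w :
  free_bracket u (free_bracket v w) + free_bracket v (free_bracket w u)
    + free_bracket w (free_bracket u v) = 0.
Proof.
elim/free_ind: u => s; elim/free_ind: v => t; elim/free_ind: w => u.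
by rewrite !free_bracketE -!free_piD; apply/free_piP; apply: ExJacobi.
Qed.

HB.instance Definition _ := Lmodule_isLieAlgebra.Build K free_lie
  free_bracket_linearl free_bracket_linearr free_bracketxx free_jacobi.

Lemma free_piL s t : free_pi (ExLie s t) = {[free_pi s, free_pi t]}.
Proof. by rewrite -free_bracketE. Qed.

Section Universal.
Variables (L : lieAlgType K) (g : 'I_r -> L).

Fixpoint expr_eval (s : lie_expr) : L :=
  match s with
  | ExVar i => g i
  | ExZero => 0
  | ExAdd s t => expr_eval s + expr_eval t
  | ExScale a s => a *: expr_eval s
  | ExLie s t => {[expr_eval s, expr_eval t]}
  end.

Lemma expr_evalP s t : expr_eq s t -> expr_eval s = expr_eval t.
Proof.
elim=> //=.
- by move=> ? ? ? _ -> _ ->.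
- by move=> ? ? ? ? _ -> _ ->.
- by move=> ? ? ? _ ->.
- by move=> ? ? ? ? _ -> _ ->.
- by move=> *; rewrite addrA.
- by move=> *; rewrite addrC.
- by move=> *; rewrite add0r.
- by move=> *; rewrite scaleN1r addNr.
- by move=> *; rewrite scalerA.
- by move=> *; rewrite scale1r.
- by move=> *; rewrite scalerDr.
- by move=> *; rewrite scalerDl.
- by move=> *; rewrite lieDl lieZl.
- by move=> *; rewrite lieDr lieZr.
- by move=> *; rewrite liexx.
- by move=> *; rewrite lie_jacobi.
Qed.

Definition free_lift (u : free_lie) : L := expr_eval (repr u).

Lemma free_liftE s : free_lift (free_pi s) = expr_eval s.
Proof. by apply: expr_evalP; apply: free_repr_pi. Qed.

Lemma free_lie_universal :
  exists! f : free_lie -> L,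
    lie_morphism f /\ forall i, f (free_gen i) = g i.
Proof.
exists free_lift; split.
  split; last by move=> i; rewrite free_liftE.
  split.
    move=> a; elim/free_ind=> s; elim/free_ind=> t.
    by rewrite -free_piZ -free_piD !free_liftE.
  elim/free_ind=> s; elim/free_ind=> t.
  by rewrite -free_piL !free_liftE.
move=> f [[flin flie] fgen]; apply/funext; elim/free_ind=> s.
have f0 : f 0 = 0.
  have := flin 1 0 0; rewrite !scale1r addr0 => H.
  by apply: (addIr (f 0)); rewrite add0r -H.
rewrite free_liftE; elim: s => [i||s IHs t IHt|a s IHs|s IHs t IHt] /=.
- by rewrite fgen.
- by rewrite f0.
- by rewrite free_piD IHs IHt; have := flin 1 (free_pi s) (free_pi t); rewrite !scale1r.
- by rewrite free_piZ IHs; have := flin a (free_pi s) 0; rewrite f0 !addr0.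
- by rewrite free_piL flie IHs IHt.
Qed.

End Universal.
End FreeLie.

Definition free_nilp_lie (K : fieldType) (r c : nat) : lieAlgType K :=
  lie_quot (lcs_ideal (free_lie K r) c.+1).

(* Main.v *)
From HB Require Import structures.
Require Import Defs.
From mathcomp Require Import all_boot all_order all_algebra.
From mathcomp Require Import boolp classical_sets functions.
From mathcomp Require Import ring.

(** Let L be the free Lie algebra on the x_i, filtered by its lower central
    series L^1 > L^2 > ..., and let D be an almost inner derivation of
    L / L^(c+1). As D and ad y are derivations, it is enough to find y with
    D(x_i) = [y, x_i] for every i. Only the values of D on linear forms
    v = sum_i a_i x_i are used: each D(v) has the form [z, v] with z depending
    on v. The element y is built one degree at a time ([almost_ad_inner]), so
    the problem at each stage is linear, in the degree k component of L, for
    values d_i of degree k.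

    Degree computations take place in the noncommutative power series. The
    expansion [magnus] : L -> K<<X>>, x_i |-> X_i, sends L^k to series of order
    at least k. In characteristic zero an element of L^k whose expansion has no
    term of degree k lies in L^(k+1) ([inF_magnus0]). This is the
    Dynkin-Specht-Wever argument: the right-normed bracketing of the degree k
    part of the expansion of u is k u modulo L^(k+1).

    A homogeneous series commuting with a nonzero linear form v is a multiple
    of a power of v ([nc_commute_lin]), and elements of L^2 have no coefficient
    at a power of a letter ([magnus_nseq]). Hence the centralizer of v is K v
    up to higher order ([inF_centralizer]), and the z of an equation
    d = [z, v] with d in L^(k+1) can be taken in L^k ([inF_lift_lie_lin]).

    In degree 2 one compares coefficients of the equations for x_i, x_j and
    x_i + x_j ([almost_ad3]). In degree k >= 3, subtract an inner derivation to
    get d_0 = 0. Then d_i = [z_t, x_i - t x_0] for every natural number t.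
    Solving for z_t letter by letter shows that z_t is a polynomial in t; its
    top coefficient commutes with x_0, hence vanishes, so that d_i = 0
    ([nc_pencil], [almost_adSS]). *)

Set Implicit Arguments.
Unset Strict Implicit.

Import GRing.Theory.

Local Open Scope ring_scope.

(** * Linear combinations and derivations *)

Section Combinations.
Variables (K : fieldType) (r : nat).
Implicit Types (M N : lmodType K) (a : 'I_r -> K).

Definition comb M (v : 'I_r -> M) a : M := \sum_i a i *: v i.

Lemma comb_linear M (v : 'I_r -> M) b a1 a2 :
  comb v (fun i => b * a1 i + a2 i) = b *: comb v a1 + comb v a2.
Proof.
rewrite /comb scaler_sumr -big_split; apply: eq_bigr => i _ /=.
by rewrite scalerA -scalerDl.
Qed.

Lemma comb_delta M (v : 'I_r -> M) i :
  comb v (fun j => (i == j)%:R) = v i.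
Proof.
rewrite /comb (bigD1 i) //= eqxx scale1r big1 ?addr0 // => j /negbTE.
by rewrite eq_sym => ->; rewrite scale0r.
Qed.

Lemma linear_fun0 M N (f : M -> N) : linear f -> f 0 = 0.
Proof.
move=> f_lin; have := f_lin 1 0 0; rewrite !scale1r addr0 => f0.
by apply: (addIr (f 0)); rewrite add0r -f0.
Qed.

Lemma linear_comb M N (f : M -> N) (v : 'I_r -> M) a :
  linear f -> f (comb v a) = comb (fun i => f (v i)) a.
Proof.
move=> f_lin; have f0 := linear_fun0 f_lin.
have fD : {morph f : u w / u + w}.
  by move=> u w; have := f_lin 1 u w; rewrite !scale1r.
rewrite /comb (big_morph f fD f0); apply: eq_bigr => i _.
by have := f_lin (a i) (v i) 0; rewrite f0 !addr0.
Qed.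

(** The Jacobi identity, in the form: ad is a morphism of Lie algebras. *)
Lemma lie_lie_l (M : lieAlgType K) (u v t : M) :
  {[{[u, v]}, t]} = {[u, {[v, t]}]} - {[v, {[u, t]}]}.
Proof.
have := lie_jacobi u v t; rewrite (lieC t u) (lieC t {[u, v]}) linearN /=.
by move/eqP; rewrite subr_eq0 eq_sym => /eqP.
Qed.

Lemma ad_Der (M : lieAlgType K) (y : M) : Der M (ad y).
Proof.
split=> [|u v]; first exact: lie_linearr.
by rewrite /ad lie_lie_l subrK.
Qed.

Lemma combB_lie (M : lieAlgType K) (v u : 'I_r -> M) y a :
  comb (fun i => v i - {[y, u i]}) a = comb v a - {[y, comb u a]}.
Proof.
rewrite /comb linear_sum -sumrB; apply: eq_bigr => i _ /=.
by rewrite scalerBr lieZr.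
Qed.

End Combinations.

(** * The lower central series as a filtration *)

Section LowerCentralSeries.
Variables (K : fieldType) (L : lieAlgType K).
Implicit Types (u v : L).

(* Membership in the n-th term, phrased with a predicate that carries the
   closure properties of a submodule, so that generic lemmas on sums and
   scalings apply to congruences modulo lcs L n. *)
Local Notation "u \inF n" := (u \in ideal_pred (lcs_ideal L n))
  (at level 70, n at level 8).

Lemma inF_lcs n u : (u \inF n) <-> lcs L n u.
Proof. by split => [/asboolP|] // ?; apply/asboolP. Qed.

Lemma inF1 u : u \inF 1. Proof. exact/inF_lcs. Qed.

Lemma inF_lie n u v : v \inF n.+1 -> {[u, v]} \inF n.+2.
Proof.
move=> /inF_lcs vn; apply/inF_lcs; apply: sub_gen_smallest.
by exists u => //; exists v.
Qed.

Lemma inF_lie_l n u v : u \inF n.+1 -> {[u, v]} \inF n.+2.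
Proof. by move=> un; rewrite lieC rpredN inF_lie. Qed.

(** Membership in a term of degree at least 2 is accessible only through
    intersections of submodules; this is the resulting induction on generators. *)
Lemma inF_ind n (P : L -> Prop) :
    P 0 -> (forall b u v, P u -> P v -> P (b *: u + v)) ->
    (forall u v, v \inF n.+1 -> P {[u, v]}) ->
  forall u, u \inF n.+2 -> P u.
Proof.
move=> P0 Plin Plie u /inF_lcs.
apply: (@smallest_sub _ _ _ [set z | P z]%classic).
  by split=> [|b y z]; rewrite !inE //=; apply: Plin.
by move=> _ [p _ [q qn ->]]; apply: Plie; apply/inF_lcs; exact: qn.
Qed.

Lemma inFS n u : u \inF n.+1 -> u \inF n.
Proof.
elim: n u => [|[|n] IH] u; [by move=> _; exact/inF_lcs | by move=> _; exact: inF1 |].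
move: u; apply: inF_ind => [|b u v Hu Hv|u v vn]; first exact: rpred0.
  by rewrite rpredD // rpredZ.
exact/inF_lie/IH.
Qed.

Lemma inFW m n u : (m <= n)%N -> u \inF n -> u \inF m.
Proof. by move/subnK <-; elim: (n - m)%N => // k IH /inFS. Qed.

Lemma inF_lieD m n u v :
  u \inF m.+1 -> v \inF n.+1 -> {[u, v]} \inF (m + n).+2.
Proof.
elim: m n u v => [|m IH] n u v um vn; first exact: inF_lie.
move: u um; apply: inF_ind => [|b y z Hy Hz|p q qm].
- by rewrite lie0x rpred0.
- by rewrite lieDl lieZl rpredD // rpredZ.
rewrite lie_lie_l; apply: rpredB; first exact/inF_lie/IH.
by rewrite addSnnS; apply: IH => //; apply: inF_lie.
Qed.

End LowerCentralSeries.

(** * Noncommutative power series *)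

Section NCSeries.
Variables (K : fieldType) (r : nat).

(** Series are functions on all words, not only finitely supported ones: orders
    and homogeneous components are then conditions on the length of words. *)
Definition ncseries : Type := seq 'I_r -> K.

HB.instance Definition _ := GRing.Lmodule.copy ncseries (seq 'I_r -> K^o).

Implicit Types (f g h : ncseries) (i j l : 'I_r) (w : seq 'I_r).

Definition nc_shift l f : ncseries := fun w => f (l :: w).

(** The Cauchy product, by recursion on the word: splitting l :: w into two
    factors either leaves the first one empty or makes it start with l. This
    form makes bilinearity and associativity inductions on the word. *)
Fixpoint ncmul_at w f g : K :=
  match w with
  | [::] => f [::] * g [::]
  | l :: w' => f [::] * g w + ncmul_at w' (nc_shift l f) g
  end.

Definition ncmul f g : ncseries := fun w => ncmul_at w f g.
Arguments ncmul : simpl never.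

Lemma ncmul_nil f g : ncmul f g [::] = f [::] * g [::].
Proof. by []. Qed.

Lemma ncmul_cons f g l w :
  ncmul f g (l :: w) = f [::] * g (l :: w) + ncmul (nc_shift l f) g w.
Proof. by []. Qed.

Lemma ncmul_linearl a f g h : ncmul (a *: f + g) h = a *: ncmul f h + ncmul g h.
Proof.
apply/funext => w.
change (ncmul (a *: f + g) h w = a * ncmul f h w + ncmul g h w).
elim: w f g => [|l w IH] f g.
  by rewrite !ncmul_nil -[(_ + _ : ncseries) _]/(a * f [::] + g [::]); ring.
rewrite !ncmul_cons -[nc_shift l (_ + _)]/(a *: nc_shift l f + nc_shift l g) IH.
by rewrite -[(_ + _ : ncseries) [::]]/(a * f [::] + g [::]); ring.
Qed.

Lemma ncmul_linearr a f g h : ncmul h (a *: f + g) = a *: ncmul h f + ncmul h g.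
Proof.
apply/funext => w.
change (ncmul h (a *: f + g) w = a * ncmul h f w + ncmul h g w).
elim: w h => [|l w IH] h.
  by rewrite !ncmul_nil -[(_ + _ : ncseries) _]/(a * f [::] + g [::]); ring.
rewrite !ncmul_cons IH.
by rewrite -[(_ + _ : ncseries) _]/(a * f (l :: w) + g (l :: w)); ring.
Qed.

Lemma nc_shift_mul l f g :
  nc_shift l (ncmul f g) = f [::] *: nc_shift l g + ncmul (nc_shift l f) g.
Proof. by []. Qed.

Lemma ncmulA f g h : ncmul f (ncmul g h) = ncmul (ncmul f g) h.
Proof.
apply/funext => w; elim: w f => [|l w IH] f; first by rewrite !ncmul_nil mulrA.
by rewrite !ncmul_cons nc_shift_mul ncmul_linearl IH ncmul_nil mulrDr mulrA -addrA.
Qed.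

Lemma ncmul0r f : ncmul 0 f = 0.
Proof.
have := ncmul_linearl 1 0 0 f; rewrite !scale1r addr0 => H.
by apply: (addIr (ncmul 0 f)); rewrite -H add0r.
Qed.

Lemma ncmulr0 f : ncmul f 0 = 0.
Proof.
have := ncmul_linearr 1 0 0 f; rewrite !scale1r addr0 => H.
by apply: (addIr (ncmul f 0)); rewrite -H add0r.
Qed.

Lemma ncmulDl f g h : ncmul (f + g) h = ncmul f h + ncmul g h.
Proof. by have := ncmul_linearl 1 f g h; rewrite !scale1r. Qed.

Lemma ncmulDr f g h : ncmul h (f + g) = ncmul h f + ncmul h g.
Proof. by have := ncmul_linearr 1 f g h; rewrite !scale1r. Qed.

Lemma ncmulNl f h : ncmul (- f) h = - ncmul f h.
Proof. by apply: (addIr (ncmul f h)); rewrite -ncmulDl !addNr ncmul0r. Qed.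

Lemma ncmulNr f h : ncmul h (- f) = - ncmul h f.
Proof. by apply: (addIr (ncmul h f)); rewrite -ncmulDr !addNr ncmulr0. Qed.

Definition nc_bracket f g : ncseries := ncmul f g - ncmul g f.

Lemma nc_bracket_linearl h : linear (nc_bracket^~ h).
Proof.
move=> a f g; rewrite /nc_bracket ncmul_linearl ncmul_linearr scalerBr opprD.
by rewrite addrACA.
Qed.

Lemma nc_bracket_linearr h : linear (nc_bracket h).
Proof.
move=> a f g; rewrite /nc_bracket ncmul_linearl ncmul_linearr scalerBr opprD.
by rewrite addrACA.
Qed.

Lemma nc_bracketxx f : nc_bracket f f = 0.
Proof. exact: subrr. Qed.

Lemma nc_bracket_jacobi f g h :
  nc_bracket f (nc_bracket g h) + nc_bracket g (nc_bracket h f)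
    + nc_bracket h (nc_bracket f g) = 0.
Proof.
rewrite /nc_bracket !(ncmulDl, ncmulDr, ncmulNl, ncmulNr) !ncmulA !opprD !opprK.
apply/funext => w; rewrite !fctE.
rewrite -[(0 : ncseries) w]/(0 : K); ring.
Qed.

HB.instance Definition _ := Lmodule_isLieAlgebra.Build K ncseries
  nc_bracket_linearl nc_bracket_linearr nc_bracketxx nc_bracket_jacobi.

Lemma nc_lieE f g w : ({[f, g]} : ncseries) w = ncmul f g w - ncmul g f w.
Proof. by []. Qed.

Definition nc_lin (a : 'I_r -> K) : ncseries :=
  fun w => if w is [:: l] then a l else 0.

Lemma nc_lin_mul_cons a f l w : ncmul (nc_lin a) f (l :: w) = a l * f w.
Proof.
rewrite ncmul_cons mul0r add0r.
case: w => [|j w]; first by rewrite ncmul_nil.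
have shift0 v g : ncmul (nc_shift j (nc_shift l (nc_lin a))) g v = 0.
  elim: v g => [|k v IH] g; first by rewrite ncmul_nil mul0r.
  rewrite ncmul_cons mul0r add0r.
  by rewrite -[nc_shift k _]/(nc_shift j (nc_shift l (nc_lin a))) IH.
by rewrite ncmul_cons shift0 addr0.
Qed.

Lemma nc_mul_lin_rcons a f w l : ncmul f (nc_lin a) (rcons w l) = f w * a l.
Proof.
elim: w f => [|j w IH] f /=; first by rewrite ncmul_cons ncmul_nil mulr0 addr0.
by rewrite ncmul_cons IH; case: w {IH} => [|? ?]; rewrite /= mulr0 add0r.
Qed.

Definition nc_order n f := forall w, (size w < n)%N -> f w = 0.

Lemma nc_order_mul m n f g :
  nc_order m f -> nc_order n g -> nc_order (m + n) (ncmul f g).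
Proof.
move=> fm gn w; elim: w m f fm => [|l w IH] [|m] f fm lt_w.
- by rewrite ncmul_nil gn ?mulr0.
- by rewrite ncmul_nil fm ?mul0r.
- rewrite ncmul_cons gn // mulr0 add0r (IH 0%N) //.
  exact: leq_trans lt_w.
- by rewrite ncmul_cons fm // mul0r add0r (IH m) // => v lt_vm; apply: fm.
Qed.

Lemma nc_order_lie m n f g :
  nc_order m f -> nc_order n g -> nc_order (m + n) {[f, g]}.
Proof.
move=> fm gn w lt_w; rewrite nc_lieE (nc_order_mul fm gn lt_w).
by rewrite (nc_order_mul gn fm) ?subr0 // addnC.
Qed.

(** Restricting series to the words on a single letter i is a morphism to the
    commutative algebra of power series in one variable. *)
Lemma ncmul_nseqC i f g n : ncmul f g (nseq n i) = ncmul g f (nseq n i).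
Proof.
have coef m h1 h2 : ncmul h1 h2 (nseq m i) =
    \sum_(k < m.+1) h1 (nseq k i) * h2 (nseq (m - k) i).
  elim: m h1 => [|m IH] h1; first by rewrite ncmul_nil big_ord1.
  by rewrite ncmul_cons IH [RHS]big_ord_recl.
rewrite !coef (reindex_inj rev_ord_inj) /=; apply: eq_bigr => k _.
by rewrite mulrC subSS subKn // -ltnS.
Qed.

(** Comparing the coefficients of f v and v f at i :: rcons w l expresses the
    coefficient of f at rcons w l as a multiple of its coefficient at i :: w.
    Rotating repeatedly, every coefficient of degree m is a multiple of the one
    at the word i^m: f is a multiple of v^m in degree m. *)
Lemma nc_commute_lin f a i m : a i != 0 ->
    (forall w, size w = m.+1 -> ncmul f (nc_lin a) w = ncmul (nc_lin a) f w) ->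
    f (nseq m i) = 0 ->
  forall w, size w = m -> f w = 0.
Proof.
move=> ai0 fC fi.
suff rot (u : seq 'I_r) : (size u <= m)%N -> f (nseq (m - size u) i ++ u) = 0.
  by move=> w wm; have := rot w; rewrite wm subnn => ->.
elim/last_ind: u => [|u l IH]; first by rewrite subn0 cats0.
rewrite size_rcons => um.
have := fC (i :: nseq (m - (size u).+1) i ++ rcons u l).
rewrite nc_lin_mul_cons -rcons_cat -rcons_cons nc_mul_lin_rcons => fCu.
apply: (mulfI ai0); rewrite -fCu; last first.
  by rewrite size_rcons /= size_cat size_nseq -addnS subnK.
have := IH (ltnW um); rewrite -[X in nseq X](_ : (m - (size u).+1).+1 = _).
  by move=> /= ->; rewrite mul0r mulr0.
by rewrite -subSn.
Qed.

Hypothesis K_char0 : [pchar K] =i pred0.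

Lemma natr_eq0 n : (n%:R == 0 :> K) = (n == 0%N).
Proof. by move/pcharf0P: K_char0 => ->. Qed.

(** The natural numbers form an infinite subset of K. *)
Lemma poly_nat_eq (p q : {poly K}) :
  (forall t : nat, p.[t%:R] = q.[t%:R]) -> p = q.
Proof.
move=> pq; apply/eqP; rewrite -subr_eq0; apply/eqP.
apply: (@roots_geq_poly_eq0 _ _ [seq t%:R | t <- iota 0 (size (p - q))]).
- by apply/allP => _ /mapP[t _ ->]; rewrite rootE !hornerE pq subrr.
- rewrite map_inj_uniq ?iota_uniq // => t1 t2 /eqP.
  wlog le_t : t1 t2 / (t1 <= t2)%N.
    by move=> H; case/orP: (leq_total t1 t2) => /H // H' /eqP/esym/eqP/H'/esym.
  rewrite eq_sym -subr_eq0 -natrB // natr_eq0 subn_eq0 => le_t'.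
  by apply/eqP; rewrite eqn_leq le_t.
- by rewrite size_map size_iota.
Qed.

(** A homogeneous g that equals [F_t, x_i1 - t x_i0] for every t vanishes, as
    long as F_t has no coefficient at powers of a letter. Reading the equation
    at the words beginning with i1, where the linear form has coefficient 1,
    determines F_t by rotations: its coefficients are polynomials P in t of
    degree at most m + 1. The identity g = [P, x_i1 - t x_i0] then holds
    between polynomials in t. If p_s is the leading coefficient of P, the
    coefficient of t^(s+1) says that p_s commutes with x_i0, so p_s = 0 by
    [nc_commute_lin]. *)
Lemma nc_pencil m g (F : nat -> ncseries) i0 i1 (al : nat -> 'I_r -> K) :
    (forall t l, al t l = (i1 == l)%:R - t%:R * (i0 == l)%:R) ->
    i0 != i1 ->
    (forall t i, F t (nseq m.+1 i) = 0) ->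
    (forall t w, size w = m.+2 ->
      g w = ncmul (F t) (nc_lin (al t)) w - ncmul (nc_lin (al t)) (F t) w) ->
  forall w, size w = m.+2 -> g w = 0.
Proof.
move=> alE i01 F0 gE.
(* The equation read at a word of length m + 2, split at both ends. *)
have gE' t l k (u : seq 'I_r) : size u = m ->
    g (l :: rcons u k) = F t (l :: u) * al t k - al t l * F t (rcons u k).
  move=> um; rewrite (gE t); last by rewrite /= size_rcons um.
  by rewrite nc_lin_mul_cons -rcons_cons nc_mul_lin_rcons.
pose A l : {poly K} := (i1 == l)%:R%:P - (i0 == l)%:R *: 'X.
have AE t l : (A l).[t%:R] = al t l by rewrite alE !hornerE mulrC.
have sA l : (size (A l) <= 2)%N.
  rewrite (leq_trans (size_polyD _ _)) // geq_max size_polyN.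
  rewrite (leq_trans (size_polyC_leq1 _)) //.
  by rewrite (leq_trans (size_scale_leq _ _)) ?size_polyX.
(* Rotation: a word with a prefix of letters i1 is reached from the power of i1
   in size u steps, each raising the degree in t by at most one. *)
have rot (u : seq 'I_r) : (size u <= m.+1)%N -> exists2 p : {poly K},
    (size p <= (size u).+1)%N &
    forall t, F t (nseq (m.+1 - size u) i1 ++ u) = p.[t%:R].
  elim/last_ind: u => [_|u l IH].
    by exists 0; rewrite ?size_poly0 // => t; rewrite cats0 F0 horner0.
  rewrite size_rcons => um; have [p sp pE] := IH (ltnW um).
  exists (p * A l - (g (i1 :: rcons (nseq (m - size u) i1 ++ u) l))%:P).
    rewrite (leq_trans (size_polyD _ _)) // geq_max size_polyN.
    rewrite (leq_trans (size_polyC_leq1 _)) // andbT.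
    rewrite (leq_trans (size_polyMleq _ _)) //.
    by rewrite -subn1 leq_subLR (leq_trans (leq_add sp (sA l))) // addn2.
  move=> t; rewrite hornerD hornerN hornerC hornerM -pE AE (gE' t); last first.
    by rewrite size_cat size_nseq subnK.
  rewrite (subSn (um : (size u <= m)%N)).
  have -> : al t i1 = 1 by rewrite alE eqxx (negbTE i01) mulr0 subr0.
  by rewrite mul1r opprB addrC subrK subSS rcons_cat.
have /choice[P PE] w : exists p : {poly K}, size w = m.+1 ->
    (size p <= m.+2)%N /\ forall t, F t w = p.[t%:R].
  have [wm|/eqP wm] := eqVneq (size w) m.+1; last by exists 0.
  have [|p] := rot w; first by rewrite wm.
  by rewrite wm subnn => sp pE; exists p.
have PgE l k (u : seq 'I_r) : size u = m ->
    (g (l :: rcons u k))%:P = P (l :: u) * A k - A l * P (rcons u k).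
  move=> um; apply: poly_nat_eq => t.
  rewrite hornerC hornerD hornerN !hornerM !AE (gE' t) //.
  have [|_ ->] := PE (l :: u); first by rewrite /= um.
  by have [|_ ->] := PE (rcons u k); first by rewrite size_rcons um.
(* Descending induction on the exponent s of t, from the degree bound m + 1. *)
have Pcoef d s : (m.+2 <= d + s)%N -> forall w, size w = m.+1 -> (P w)`_s = 0.
  elim: d s => [|d IH] s ds.
    by move=> w /PE[sP _]; rewrite nth_default // (leq_trans sP).
  have {}IH := IH s.+1; rewrite addnS in IH; have {}IH := IH ds.
  apply: (@nc_commute_lin (fun w => (P w)`_s : K) (fun l => (i0 == l)%:R) i0).
  - by rewrite eqxx oner_neq0.
  - case=> // l w [wm]; case/lastP: w wm => // u k; rewrite size_rcons => -[um].
    rewrite nc_lin_mul_cons -rcons_cons nc_mul_lin_rcons.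
    have /(congr1 (fun p : {poly K} => p`_s.+1)) := PgE l k u um.
    rewrite /A coefC /= mulrBr mulrBl !coefB.
    rewrite coefMC coefCM -scalerAr -scalerAl !coefZ coefMX coefXM /=.
    rewrite !IH /= ?um ?size_rcons ?um // mul0r mulr0 !sub0r opprK.
    by move/esym/eqP; rewrite addrC subr_eq0 => /eqP sE; rewrite /= mulrC sE.
  - have [|_ P0] := PE (nseq m.+1 i0); first by rewrite size_nseq.
    by rewrite (_ : P _ = 0) ?coef0 //; apply: poly_nat_eq => t; rewrite -P0 F0 horner0.
have P0 w : size w = m.+1 -> P w = 0.
  by move=> wm; apply/polyP => s; rewrite coef0 (@Pcoef m.+2) ?leq_addr.
case=> // l w [wm]; case/lastP: w wm => // u k; rewrite size_rcons => -[um].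
apply: polyC_inj; rewrite PgE // !P0 ?size_rcons /= ?um //.
by rewrite mul0r mulr0 subrr.
Qed.

End NCSeries.

(** * The free Lie algebra and its Magnus expansion *)

Section FreeLieAlgebra.
Variables (K : fieldType) (r : nat).
Local Notation L := (free_lie K r).
Local Notation T := (ncseries K r).
Local Notation x := (@free_gen K r).
Local Notation lin := (comb x).
Local Notation "u \inF n" := (u \in ideal_pred (lcs_ideal L n))
  (at level 70, n at level 8).
Implicit Types (u v : L) (f g : T) (w : seq 'I_r) (a : 'I_r -> K).

Lemma free_lie_ind (P : L -> Prop) :
    P 0 -> (forall b u v, P u -> P v -> P (b *: u + v)) ->
    (forall i, P (x i)) -> (forall u v, P u -> P v -> P {[u, v]}) ->
  forall u, P u.
Proof.
move=> P0 Plin Pgen Plie; elim/free_ind; elim=> //.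
- by move=> s Ps t Pt; rewrite free_piD -[free_pi s]scale1r; apply: Plin.
- by move=> b s Ps; rewrite free_piZ -[_ *: _]addr0; apply: Plin.
- by move=> s Ps t Pt; rewrite free_piL; apply: Plie.
Qed.

(** The abelianization of L is spanned by the generators. *)
Lemma free_lie_lin u : exists a, u - lin a \inF 2.
Proof.
have lin0 : lin (fun=> 0) = 0 by apply: big1 => i _; rewrite scale0r.
elim/free_lie_ind: u => [|b u v [a1 H1] [a2 H2]|i|u v _ _].
- by exists (fun=> 0); rewrite lin0 subr0 rpred0.
- exists (fun i => b * a1 i + a2 i).
  by rewrite comb_linear opprD addrACA -scalerBr rpredD // rpredZ.
- by exists (fun j => (i == j)%:R); rewrite comb_delta subrr rpred0.
- by exists (fun=> 0); rewrite lin0 subr0; apply/inF_lie/inF1.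
Qed.

(** Although called an expansion, this is the Lie morphism x_i |-> X_i, not the
    group morphism x_i |-> 1 + X_i. *)
Definition magnus : L -> T :=
  free_lift (fun i => nc_lin (fun j => (i == j)%:R)).

Lemma magnus_linear b u v : magnus (b *: u + v) = b *: magnus u + magnus v.
Proof.
elim/free_ind: u => s; elim/free_ind: v => t.
by rewrite -free_piZ -free_piD /magnus !free_liftE.
Qed.

HB.instance Definition _ := GRing.isLinear.Build K L T *:%R magnus magnus_linear.

Lemma magnusDE u v w : magnus (u + v) w = magnus u w + magnus v w.
Proof. by rewrite linearD. Qed.

Lemma magnusBE u v w : magnus (u - v) w = magnus u w - magnus v w.
Proof. by rewrite linearB. Qed.

Lemma magnus_lie u v : magnus {[u, v]} = {[magnus u, magnus v]}.
Proof.
elim/free_ind: u => s; elim/free_ind: v => t.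
by rewrite -free_piL /magnus !free_liftE.
Qed.

Lemma magnus_gen i : magnus (x i) = nc_lin (fun j => (i == j)%:R).
Proof. by rewrite /magnus free_liftE. Qed.

Lemma nc_sumE (I : finType) (F : I -> T) w : (\sum_i F i) w = \sum_i (F i w : K).
Proof. by rewrite fct_sumE. Qed.

Lemma magnus_lin a : magnus (lin a) = nc_lin a.
Proof.
rewrite /comb linear_sum; apply/funext => w; rewrite nc_sumE.
case: w => [|l [|? ?]]; last 1 first.
- by apply: big1 => i _; rewrite linearZ /= magnus_gen; apply: mulr0.
- by apply: big1 => i _; rewrite linearZ /= magnus_gen; apply: mulr0.
rewrite (bigD1 l) //= linearZ /= magnus_gen.
rewrite -[X in X + _]/(a l * (l == l)%:R) eqxx mulr1 big1 ?addr0 // => i.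
move=> /negbTE il; rewrite linearZ /= magnus_gen.
by rewrite -[LHS]/(a i * (i == l)%:R) il mulr0.
Qed.

Lemma magnus_order1 u : nc_order 1 (magnus u).
Proof.
move=> [|//] _.
elim/free_lie_ind: u => [|b u v Hu Hv|i|u v Hu Hv].
- by rewrite linear0.
- by rewrite linearP -[LHS]/(b * magnus u [::] + magnus v [::]) Hu Hv mulr0 addr0.
- by rewrite magnus_gen.
- by rewrite magnus_lie nc_lieE !ncmul_nil Hu Hv subrr.
Qed.

Lemma magnus_order n u : u \inF n -> nc_order n (magnus u).
Proof.
case: n => [|n]; first by move=> _ w.
elim: n u => [|n IH] u; first by move=> _; apply: magnus_order1.
move: u; apply: inF_ind => [|b u v Hu Hv w ltw|u v vn].
- by rewrite linear0.
- by rewrite linearP -[LHS]/(b * magnus u w + magnus v w) Hu // Hv // mulr0 addr0.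
- by rewrite magnus_lie; apply: (nc_order_lie (magnus_order1 u)); apply: IH.
Qed.

(** A bracket dies in the commutative algebra of series in one letter. *)
Lemma magnus_nseq u i n : u \inF 2 -> magnus u (nseq n i) = 0.
Proof.
move: u; apply: inF_ind => [|b u v Hu Hv|u v _].
- by rewrite linear0.
- by rewrite linearP -[LHS]/(b * magnus u _ + magnus v _) Hu // Hv // mulr0 addr0.
- by rewrite magnus_lie nc_lieE ncmul_nseqC subrr.
Qed.

Lemma magnus_lie_lin_cons z a l w k :
  magnus {[z, lin a]} (l :: rcons w k) =
    magnus z (l :: w) * a k - a l * magnus z (rcons w k).
Proof.
rewrite magnus_lie magnus_lin nc_lieE nc_lin_mul_cons.
by rewrite -rcons_cons nc_mul_lin_rcons.
Qed.

(** * The Dynkin operator *)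

(** The Dynkin operator: the word i_1 ... i_n is sent to the right-normed
    bracket [x_i1, [x_i2, ... x_in]], and words of length other than n to 0. *)
Fixpoint dynkin n f : L :=
  match n with
  | 0 => 0
  | 1 => lin (fun i => f [:: i])
  | n'.+1 => \sum_i {[x i, dynkin n' (nc_shift i f)]}
  end.
Arguments dynkin : simpl never.

Lemma dynkinSS n f :
  dynkin n.+2 f = \sum_i {[x i, dynkin n.+1 (nc_shift i f)]}.
Proof. by []. Qed.

Lemma dynkin_linear n b f g : dynkin n (b *: f + g) = b *: dynkin n f + dynkin n g.
Proof.
elim: n f g => [|[|n] IH] f g; first by rewrite scaler0 addr0.
  exact: comb_linear.
rewrite !dynkinSS scaler_sumr -big_split; apply: eq_bigr => i _.
by rewrite -[nc_shift i _]/(b *: nc_shift i f + nc_shift i g) IH lieDr lieZr.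
Qed.

HB.instance Definition _ n :=
  GRing.isLinear.Build K T L *:%R (dynkin n) (@dynkin_linear n).

Lemma dynkin_inF n f : dynkin n f \inF n.
Proof.
elim: n f => [|[|n] IH] f; [exact: rpred0 | exact: inF1 |].
by rewrite dynkinSS rpred_sum // => i _; apply/inF_lie/IH.
Qed.

Lemma dynkin_eq0 n f : (forall w, size w = n -> f w = 0) -> dynkin n f = 0.
Proof.
elim: n f => [|[|n] IH] f f0 //.
  by rewrite /dynkin /comb big1 // => i _; rewrite f0 // scale0r.
rewrite dynkinSS big1 // => i _; rewrite IH ?linear0 // => w sw.
by apply: f0; rewrite /= sw.
Qed.

Lemma dynkin_mul_gen n f i :
  dynkin n.+2 (ncmul (magnus (x i)) f) = {[x i, dynkin n.+1 f]}.
Proof.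
rewrite dynkinSS magnus_gen (bigD1 i) //= big1 ?addr0 => [|j /negbTE ij].
  congr {[_, dynkin _ _]}; apply/funext => w.
  by rewrite /nc_shift nc_lin_mul_cons eqxx mul1r.
suff -> : nc_shift j (ncmul (nc_lin (fun k => (i == k)%:R)) f) = 0.
  by rewrite !linear0.
apply/funext => w.
by rewrite /nc_shift nc_lin_mul_cons eq_sym ij mul0r.
Qed.

(** Dynkin's key property: left multiplication by the expansion of u becomes
    ad u. For u in L^2 both terms have too high an order to be seen, so only
    generators matter. *)
Lemma dynkin_mul1 m u f : nc_order m.+1 f ->
  dynkin m.+2 (ncmul (magnus u) f) - {[u, dynkin m.+1 f]} \inF m.+3.
Proof.
move=> fm; elim/free_lie_ind: u => [|b u v Hu Hv|i|u v _ _].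
- by rewrite linear0 ncmul0r linear0 lie0x subrr rpred0.
- rewrite linearP /= ncmul_linearl linearP /= lieDl lieZl opprD addrACA -scalerBr.
  by rewrite rpredD // rpredZ.
- by rewrite dynkin_mul_gen subrr rpred0.
- rewrite dynkin_eq0 => [|w sw]; last first.
    have uv2 : {[u, v]} \inF 2 by apply/inF_lie/inF1.
    by apply: (nc_order_mul (magnus_order uv2) fm); rewrite sw.
  rewrite sub0r rpredN; apply: (@inF_lieD _ _ 1 m); last exact: dynkin_inF.
  exact/inF_lie/inF1.
Qed.

(** The same property with the precision adapted to the order of u; the factor
    [p, q] acts through p and q successively. *)
Lemma dynkin_mul j m u f : u \inF j.+1 -> nc_order m.+1 f ->
  dynkin (j + m).+2 (ncmul (magnus u) f) - {[u, dynkin m.+1 f]} \inF (j + m).+3.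
Proof.
elim: j m u f => [|j IH] m u f uj fm; first exact: dynkin_mul1.
move: u uj; apply: inF_ind => [|b u v Hu Hv|p q qj].
- by rewrite linear0 ncmul0r linear0 lie0x subrr rpred0.
- rewrite linearP /= ncmul_linearl linearP /= lieDl lieZl opprD addrACA -scalerBr.
  by rewrite rpredD // rpredZ.
have qfm : nc_order (j + m).+2 (ncmul (magnus q) f).
  by rewrite -addSn -addnS; apply: nc_order_mul => //; apply: magnus_order.
have pfm : nc_order m.+2 (ncmul (magnus p) f).
  exact: (nc_order_mul (magnus_order1 p) fm).
have Hp := dynkin_mul1 p qfm.
have Hpq : {[p, dynkin (j + m).+2 (ncmul (magnus q) f) - {[q, dynkin m.+1 f]}]}
    \inF (j + m).+4 by apply/inF_lie/IH.
have Hq := IH _ _ _ qj pfm.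
have Hqp : {[q, dynkin m.+2 (ncmul (magnus p) f) - {[p, dynkin m.+1 f]}]}
    \inF (j + m.+2).+2 by apply: inF_lieD => //; apply: dynkin_mul1.
rewrite !addnS in Hq Hqp; rewrite addSn.
have -> : ncmul (magnus {[p, q]}) f =
    ncmul (magnus p) (ncmul (magnus q) f) - ncmul (magnus q) (ncmul (magnus p) f).
  by rewrite magnus_lie !ncmulA -ncmulNl -ncmulDl.
rewrite linearB /= lie_lie_l.
move: (rpredB (rpredD Hp Hpq) (rpredD Hq Hqp)); rewrite !lieBr.
congr (_ \inF _); rewrite !subrKA !opprD !opprK.
by rewrite addrACA.
Qed.

Lemma dynkin1_magnus u : dynkin 1 (magnus u) - u \inF 2.
Proof.
have [a ua] := free_lie_lin u.
suff -> : dynkin 1 (magnus u) = lin a by rewrite -opprB rpredN.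
apply/eqP; rewrite -subr_eq0; apply/eqP.
have -> : lin a = dynkin 1 (magnus (lin a)) by rewrite magnus_lin.
rewrite -!linearB /=; apply: dynkin_eq0 => w sw.
by apply: (magnus_order ua); rewrite sw.
Qed.

(** The Dynkin-Specht-Wever theorem modulo higher order: by [dynkin_mul], u |->
    dynkin (magnus u) behaves as the derivation of L fixing the generators,
    which multiplies brackets of k generators by k. *)
Lemma dynkin_magnus k u : u \inF k.+1 ->
  dynkin k.+1 (magnus u) - k.+1%:R *: u \inF k.+2.
Proof.
elim: k u => [|k IH] u; first by rewrite scale1r => _; apply: dynkin1_magnus.
move: u; apply: inF_ind => [|b u v Hu Hv|p q qk].
- by rewrite linear0 linear0 scaler0 subrr rpred0.
- rewrite linearP /= linearP /= scalerDr scalerA mulrC -scalerA opprD addrACA -scalerBr.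
  by rewrite rpredD // rpredZ.
have Hp := dynkin_mul1 p (magnus_order qk).
have Hq := dynkin_mul qk (magnus_order1 p).
have Hpq : {[p, dynkin k.+1 (magnus q) - k.+1%:R *: q]} \inF k.+3.
  exact/inF_lie/IH.
have Hqp : {[q, dynkin 1 (magnus p) - p]} \inF (k + 1).+2.
  exact/inF_lieD/dynkin1_magnus.
rewrite addn0 in Hq; rewrite addn1 in Hqp.
rewrite magnus_lie.
rewrite -[{[magnus p, _]}]/(ncmul (magnus p) (magnus q)
                             - ncmul (magnus q) (magnus p)).
rewrite linearB /=.
move: (rpredB (rpredD Hp Hpq) (rpredD Hq Hqp)); rewrite !lieBr lieZr.
congr (_ \inF _).
rewrite !subrKA (lieC q p) opprK opprD addrACA -opprD.
by rewrite -[k.+2]addn1 natrD scalerDl scale1r.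
Qed.

Hypothesis K_char0 : [pchar K] =i pred0.

(** Injectivity of the expansion on each quotient L^k / L^(k+1): by
    [dynkin_magnus] such a u has k u in L^(k+1), and k is invertible. *)
Lemma inF_magnus0 k u : u \inF k.+1 ->
  (forall w, size w = k.+1 -> magnus u w = 0) -> u \inF k.+2.
Proof.
move=> uk u0; have := dynkin_magnus uk.
rewrite dynkin_eq0 // sub0r rpredN => ku.
have k0 : k.+1%:R != 0 :> K by rewrite natr_eq0.
by rewrite -[u]scale1r -(mulVf k0) -scalerA rpredZ.
Qed.

(** * Centralizers of linear forms *)

(** The degree j + 1 component of the expansion of z commutes with the linear
    form, hence is a multiple of its (j+1)-st power. For j = 0 this is the
    multiple b; for j > 0 no power of degree at least 2 is the leading term of
    a Lie element, and b = 0. *)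
Lemma inF_centralizer j z a i : a i != 0 ->
    z \inF j.+1 -> {[z, lin a]} \inF j.+3 ->
  exists b, z - b *: lin a \inF j.+2.
Proof.
move=> ai0 zj zaj.
have [b bj bi] : exists2 b, z - b *: lin a \inF j.+1 &
    magnus (z - b *: lin a) (nseq j.+1 i) = 0.
  case: j zj {zaj} => [|j] zj.
    exists (magnus z [:: i] / a i); first exact: inF1.
    rewrite linearB linearZ /= magnus_lin.
    rewrite -[LHS]/(magnus z [:: i] - magnus z [:: i] / a i * a i).
    by rewrite divfK // subrr.
  by exists 0; rewrite scale0r subr0 // magnus_nseq // (@inFW _ _ _ j.+2).
exists b; apply: inF_magnus0 => //.
apply: (nc_commute_lin ai0) bi => w wj.
have : {[z - b *: lin a, lin a]} \inF j.+3 by rewrite lieBl lieZl liexx scaler0 subr0.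
move/magnus_order/(_ w); rewrite wj => /(_ (leqnn _)).
by rewrite magnus_lie magnus_lin nc_lieE => /eqP; rewrite subr_eq0 => /eqP.
Qed.

(** As long as z is not in L^(k+1), its leading component commutes with the
    linear form; by [inF_centralizer] subtracting a multiple of that form
    raises the order of z, and this leaves the bracket unchanged. *)
Lemma inF_lift_lie_lin k z a i : a i != 0 -> {[z, lin a]} \inF k.+2 ->
  exists2 z', z' \inF k.+1 & {[z', lin a]} = {[z, lin a]}.
Proof.
move=> ai0; elim: k => [|k IH] zk; first by exists z; first exact: inF1.
have [z' z'k z'E] := IH (inFS zk); rewrite -z'E in zk *.
have [b z'b] := inF_centralizer ai0 z'k zk.
by exists (z' - b *: lin a); rewrite // lieBl lieZl liexx scaler0 subr0.
Qed.

(** * Almost inner values on the generators *)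

(** The trace on the generators of the almost inner condition: d i stands for
    the value at x i of a derivation, known modulo the n-th term, and only
    linear forms are tested. *)
Definition almost_ad n (d : 'I_r -> L) :=
  forall a, exists z, comb d a - {[z, lin a]} \inF n.

Lemma almost_adW m n d : (m <= n)%N -> almost_ad n d -> almost_ad m d.
Proof. by move=> le_mn dn a; have [z] := dn a; exists z; apply: inFW le_mn _. Qed.

Lemma almost_adB n d y : almost_ad n d -> almost_ad n (fun i => d i - {[y, x i]}).
Proof.
move=> dn a; have [z dz] := dn a; exists (z - y).
by rewrite combB_lie lieBl opprB subrKA.
Qed.

(** Modulo L^3 only the linear parts Y i of the elements y_i with d_i = [y_i, x_i]
    matter, and the l-th coordinate of Y i is significant only for l <> i.
    Testing x_i + x_j shows that Y i and Y j have the same l-th coordinate when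
    l differs from i and j, so the significant coordinates glue together. *)
Lemma almost_ad3 d : almost_ad 3 d -> exists y, forall i, d i - {[y, x i]} \inF 3.
Proof.
move=> d3.
have {}d3 a : exists b, comb d a - {[lin b, lin a]} \inF 3.
  have [z dz] := d3 a; have [b zb] := free_lie_lin z; exists b.
  rewrite -(subrKA {[z, lin a]}) rpredD // -lieBl.
  exact: (@inF_lieD _ _ 1 0 _ _ zb (inF1 _)).
have /choice[Y dY] i : exists b, d i - {[lin b, x i]} \inF 3.
  by have [b] := d3 (fun j => (i == j)%:R); rewrite !comb_delta; exists b.
have Ycompat i j l : l != i -> l != j -> i != j -> Y i l = Y j l.
  move=> li lj ij.
  (* The coordinates of x_i + x_j, in the shape expected by comb_linear. *)
  have [b] := d3 (fun k => 1 * (i == k)%:R + (j == k)%:R).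
  rewrite !comb_linear !comb_delta !scale1r lieDr => db.
  have := rpredB db (rpredD (dY i) (dY j)).
  rewrite (addrACA (d i) (- {[lin (Y i), _]})) -opprD opprB.
  rewrite [_ - _ + (_ - _)]addrC subrKA => /magnus_order E.
  have {E} coef k : Y i l * (i == k)%:R + Y j l * (j == k)%:R =
      b l * (i == k)%:R + b l * (j == k)%:R.
    have /eqP := E [:: l; k] isT.
    rewrite magnusBE !magnusDE -!(comb_delta x) !(magnus_lie_lin_cons _ _ _ [::]).
    rewrite !magnus_lin /= ![_ == l]eq_sym (negbTE li) (negbTE lj) !mul0r !subr0.
    by rewrite subr_eq0 => /eqP.
  have := coef i; have := coef j.
  rewrite !eqxx (negbTE ij) [j == i]eq_sym (negbTE ij).
  by rewrite !mulr1 !mulr0 !add0r !addr0 => -> ->.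
(* The l-th coordinate can be read off any Y i with i != l; there is no such i
   when l is the only letter, and then any value works. *)
exists (lin (fun l => if [pick i | i != l] is Some i then Y i l else 0)) => i.
set y := (fun l => _); rewrite -(subrKA {[lin (Y i), x i]}) rpredD ?dY // -lieBl.
have -> : lin (Y i) - lin y = (Y i i - y i) *: x i.
  rewrite /comb -sumrB (bigD1 i) //= big1 ?addr0 ?scalerBl // => l li.
  rewrite /y; case: pickP => [k kl|/(_ i)]; last by rewrite eq_sym li.
  have [->|ik] := eqVneq k i; first by rewrite subrr.
  by rewrite (Ycompat i k) ?subrr // eq_sym.
by rewrite lieZl liexx scaler0 rpred0.
Qed.

(** An inner modification gives d i0 = 0 in the leading degree. The equations for
    the linear forms x i1 - t x i0 then all have the same left-hand side d i1,
    and [nc_pencil] applies to it. *)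
Lemma almost_adSS n d : 'I_r -> almost_ad n.+4 d ->
  (forall i, d i \inF n.+3) -> exists y, forall i, d i - {[y, x i]} \inF n.+4.
Proof.
move=> i0 dn4 dn3.
have [z dz] := dn4 (fun j => (i0 == j)%:R).
have zn : {[z, lin (fun j => (i0 == j)%:R)]} \inF n.+3.
  rewrite -(subKr (comb d (fun j => (i0 == j)%:R)) {[z, _]}).
  by apply: rpredB; [rewrite comb_delta; apply: dn3 | apply: inFS dz].
have i00 : (i0 == i0)%:R != 0 :> K by rewrite eqxx oner_neq0.
have [y yn yE] := inF_lift_lie_lin i00 zn.
rewrite -yE !comb_delta in dz; exists y => i1.
have [<-//|i01] := eqVneq i0 i1.
have {}dn4 := almost_adB y dn4.
have {}dn3 i : d i - {[y, x i]} \inF n.+3 by rewrite rpredB ?dn3 ?inF_lie_l.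
set w := d i1 - _.
pose al (t : nat) l : K := (i1 == l)%:R - t%:R * (i0 == l)%:R.
have alE t : al t = (fun l => - t%:R * (i0 == l)%:R + (i1 == l)%:R).
  by apply/funext => l; rewrite /al mulNr addrC.
have al1 t : al t i1 != 0.
  by rewrite /al eqxx (negbTE i01) mulr0 subr0 oner_neq0.
have /choice[Z ZP] t : exists z', z' \inF n.+2 /\ w - {[z', lin (al t)]} \inF n.+4.
  have [z'] := dn4 (al t).
  rewrite {1}alE comb_linear !comb_delta -/w scaleNr -addrA rpredDl ?rpredN ?rpredZ // => wz.
  have z'n : {[z', lin (al t)]} \inF n.+3.
    rewrite -(subKr w {[z', _]}); apply: rpredB; first exact: dn3.
    exact: inFS wz.
  have [z'' z''n z''E] := inF_lift_lie_lin (al1 t) z'n.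
  by exists z''; rewrite z''E.
apply: inF_magnus0; first exact: dn3.
apply: (@nc_pencil _ _ K_char0 n.+1 _ (magnus \o Z) i0 i1 al) => // t.
  by move=> i; apply: (@magnus_nseq (Z t) i n.+2); apply: inFW (ZP t).1.
move=> u un; apply/eqP; rewrite -subr_eq0 -nc_lieE -magnus_lin -magnus_lie.
have /magnus_order/(_ u) := (ZP t).2.
by rewrite linearB un => /(_ (leqnn _)) /eqP.
Qed.

(** Degree by degree: y is correct on all generators up to an error in the next
    degree, which is again almost inner and is absorbed by a correction y'. *)
Lemma almost_ad_inner c d : 'I_r -> almost_ad c.+2 d ->
  exists y, forall i, d i - {[y, x i]} \inF c.+2.
Proof.
move=> i0; elim: c d => [|[|c] IH] d dc.
- exists 0 => i; have [z] := dc (fun j => (i == j)%:R).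
  rewrite !comb_delta lie0x subr0 => dz.
  by rewrite -(subrK {[z, x i]} (d i)) rpredD // inF_lie ?inF1.
- exact: almost_ad3.
have [y dy] := IH d (almost_adW (leqnSn _) dc).
have [y' dy'] := almost_adSS i0 (almost_adB y dc) dy.
by exists (y + y') => i; rewrite lieDl opprD addrA.
Qed.

End FreeLieAlgebra.

(** * Passage to the free nilpotent quotient *)

Section NilpotentQuotient.
Variables (K : fieldType) (r c : nat).
Local Notation L := (free_lie K r).
Local Notation G := (free_nilp_lie K r c).
Local Notation x := (@free_gen K r).
Local Notation pi := (@lie_pi K L (lcs_ideal L c.+1)).

Lemma pi_lie u v : pi {[u, v]} = {[pi u, pi v]} :> G.
Proof. exact: (lie_pi_morphism _).2. Qed.

Lemma pi_comb (v : 'I_r -> L) a :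
  pi (comb v a) = comb (fun i => pi (v i) : G) a.
Proof.
rewrite /comb (big_morph pi (@lie_piD _ _ _) (lie_pi0 _)).
by apply: eq_bigr => i _; rewrite lie_piZ.
Qed.

Lemma Der_eq_gen (D1 D2 : G -> G) : Der G D1 -> Der G D2 ->
  (forall i, D1 (pi (x i)) = D2 (pi (x i))) -> D1 = D2.
Proof.
move=> [lin1 der1] [lin2 der2] genE; apply/funext => U.
rewrite -(lie_reprK U); elim/free_lie_ind: (lie_repr U) => //.
- by rewrite lie_pi0 !linear_fun0.
- by move=> b u v Hu Hv; rewrite lie_piD lie_piZ lin1 lin2 Hu Hv.
- by move=> u v Hu Hv; rewrite pi_lie der1 der2 Hu Hv.
Qed.

Lemma AID_almost_ad (D : G -> G) : AID G D ->
  almost_ad c.+1 (fun i => lie_repr (D (pi (x i)))).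
Proof.
move=> [[D_lin _] D_ai] a; have [z _ zE] := D_ai (pi (comb x a)).
exists (lie_repr z); apply/inF_lcs.
apply: (lie_piP (lcs_ideal L c.+1) _ _).1.
rewrite pi_lie lie_reprK zE !pi_comb (linear_comb _ _ D_lin).
by congr (comb _ a); apply/funext => i; rewrite lie_reprK.
Qed.

End NilpotentQuotient.

Unset Implicit Arguments.

Theorem theorem2p2 (K : fieldType) (r c : nat)
  (K_char0 : [pchar K] =i pred0) (r_ge1 : (1 <= r)%N) (c_ge1 : (1 <= c)%N) :
  AID (free_nilp_lie K r c) = Inn (free_nilp_lie K r c).
Proof.
case: c c_ge1 => // c _; apply/seteqP; split=> [D D_ai|_ [y _ <-]]; last first.
  by split=> [|u]; [exact: ad_Der | exists y].
have [y yE] := almost_ad_inner K_char0 (Ordinal r_ge1) (AID_almost_ad D_ai).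
exists (lie_pi (lcs_ideal (free_lie K r) c.+2) y) => //.
apply: Der_eq_gen (ad_Der _) D_ai.1 _ => i.
by rewrite /ad -pi_lie -(lie_reprK (D _)); apply/esym/lie_piP/inF_lcs/yE.
Qed.
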